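(* There is a constant $C>0$ such that for every $f\in C[0,\pi]$, every $\theta\in[0,\pi]$ and every $n\in\mathbb{N}$, with $x=\cos\theta$, $$|\mathcal{GK}_n(f)(\theta)-f(\theta)|\le C\left(\omega\left(f\circ\arccos,\frac{\sqrt{1-x^2}}{n}\right)+\omega\left(f\circ\arccos,\frac{1}{n^2}\right)+\omega\left(f,\frac{\pi}{n}\right)\right).$$
   Context: For $n\in\mathbb{N}$ and $k=1,\dots,n$ let $\theta_k^{(n)}=\frac{(2k-1)\pi}{2n}$ and, for real $\theta$, let $$P_k(\theta)=(-1)^{k+1}\frac{\cos(n\theta)\sin\theta_k^{(n)}}{n(\cos\theta-\cos\theta_k^{(n)})}$$ (the dependence on $n$ is suppressed; $P_k$ is extended by continuity at the removable singularities, so it is a polynomial in $\cos\theta$, namely the fundamental Lagrange polynomial at the Chebyshev nodes $\cos\theta_k^{(n)}$ evaluated at $\cos\theta$). The Grünwald–Kantorovich operators are defined for integrable $f$ on $[0,\pi]$ and $\theta\in[0,\pi]$ by $$\mathcal{GK}_n(f)(\theta)=\frac{n}{\pi}\sum_{k=1}^n\left(\int_{\theta_k^{(n)}}^{\theta_k^{(n)}+\frac{\pi}{2n}}f(t)\,dt\right)\left\{P_k\left(\theta+\frac{\pi}{2n}\right)+P_k\left(\theta-\frac{\pi}{2n}\right)\right\}.$$ For a bounded function $h:I\to\mathbb{R}$ on a real interval $I$ and $\delta\ge 0$, the modulus of continuity is $\omega(h,\delta)=\sup\{|h(x)-h(y)|:|x-y|\le\delta,\ x,y\in I\}$. Here $f$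 is considered on $I=[0,\pi]$ and $f\circ\arccos$ on $I=[-1,1]$. *)

(* Defs.v *)
From HB Require Import structures.
From mathcomp Require Import all_boot all_order all_algebra.
From mathcomp Require Import all_classical all_reals all_analysis.

Set Implicit Arguments.
Unset Strict Implicit.
Unset Printing Implicit Defensive.

Import Order.TTheory GRing.Theory Num.Theory.
Import numFieldNormedType.Exports.

Local Open Scope classical_set_scope.
Local Open Scope ring_scope.

Definition cheb_angle (R : realType) (n k : nat) : R :=
  (2 * k%:R - 1) * pi / (2 * n%:R).

Definition lagrange_quot (R : realType) (n k : nat) (t : R) : R :=
  (-1) ^+ k.+1 * (cos (n%:R * t) * sin (cheb_angle R n k)) /
    (n%:R * (cos t - cos (cheb_angle R n k))).

(* The limit is over the punctured neighbourhood [t^'], i.e. the quotient is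
   extended by continuity at its (removable) singularities. *)
Definition lagrange_basis (R : realType) (n k : nat) (t : R) : R :=
  if cos t == cos (cheb_angle R n k)
  then lim (lagrange_quot n k s @[s --> t^'])
  else lagrange_quot n k t.

Definition GK (R : realType) (n : nat) (f : R -> R) (t : R) : R :=
  n%:R / pi * \sum_(1 <= k < n.+1)
    (\int[lebesgue_measure]_(s in
        `[cheb_angle R n k, cheb_angle R n k + pi / (2 * n%:R)]) f s) *
    (lagrange_basis n k (t + pi / (2 * n%:R)) +
     lagrange_basis n k (t - pi / (2 * n%:R))).

(* [sup] is the real-valued supremum, hence the usual one as soon as [h] is
   bounded on the nonempty set [I] and [0 <= d]. *)
Definition modulus (R : realType) (I : set R) (h : R -> R) (d : R) : R :=
  sup [set `|h xy.1 - h xy.2| | xy in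
        [set xy : R * R | [/\ I xy.1, I xy.2 & `|xy.1 - xy.2| <= d]]].

(* Main.v *)
Require Import Defs.
From HB Require Import structures.
From mathcomp Require Import all_boot all_order all_algebra.
From mathcomp Require Import all_classical all_reals all_analysis.
From mathcomp Require Import ring lra zify.
Import Order.TTheory GRing.Theory Num.Theory.
Import numFieldNormedType.Exports.

Local Open Scope classical_set_scope.
Local Open Scope ring_scope.

(** Write [h = pi / (2 n)], [b_i = (2 i + 1) h] for the nodes and
    [A_i = (P_i (theta + h) + P_i (theta - h)) / 2], so that
    [GK n f theta] is the sum of the [A_i F_i], where [F_i] is the mean of [f]
    on [[b_i, b_i + h]], and the [A_i] sum to [1]. Since
    [cos (n (theta +- h)) = -+ sin (n theta)], beyond the node nearest to
    [theta] one has [A_i = (-1)^(i+1) sin (n theta) g_i], where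
    [g_i = sin b_i / (2 n) * (1 / (cos (theta + h) - cos b_i)
                              - 1 / (cos (theta - h) - cos b_i))]
    is nonnegative and decreasing in [i]. By the addition formula for the
    cotangent, [g_i] is at most
    [(cot ((b_i - theta - h) / 2) - cot ((b_i - theta + h) / 2)) / (4 n)],
    which telescopes because [b_(i+1) = b_i + 2 h], so that the sum of the
    [g_i] is bounded. Summation by parts turns the sum of the
    [A_i (F_i - F_m)] into a sum of differences [F_(i+1) - F_i], each at most
    [2 omega (f, pi / n)], against tails of an alternating series, each at most
    [g_i]. The nodes on the other side of [theta] are handled by the reflection
    [theta -> pi - theta]. The term [omega (f, pi / n)] alone suffices; the two
    other moduli only have to be nonnegative. *)

(** * Modulus of continuity and means over an interval *)

Section Modulus.
Set Implicit Arguments.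
Unset Strict Implicit.
Context {R : realType}.
Lemma modulus_ge0 (I : set R) (h : R -> R) (d : R) : 0 <= modulus I h d.
Proof.
rewrite /modulus; set E := (X in sup X).
(* On a set that has no supremum, [sup] takes the default value 0. *)
have [hE|hE] := pselect (has_sup E); last by rewrite sup_out.
have [z [xy Exy zE]] := hE.1.
have z0 : 0 <= z by rewrite -zE.
by apply: le_trans z0 _; apply: sup_upper_bound => //; exists xy.
Qed.

(** By the extreme value theorem the oscillation of [f] is at most [f M - f m], so the set under
    [sup] is bounded above and its [sup] is a genuine upper bound. *)
Lemma le_modulus (a b : R) (f : R -> R) (d x y : R) :
  {within `[a, b], continuous f} -> x \in `[a, b] -> y \in `[a, b] ->
  `|x - y| <= d -> `|f x - f y| <= modulus `[a, b] f d.
Proof.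
move=> cf xab yab xyd; apply: ub_le_sup; last first.
  by exists (x, y).
have leab : a <= b by move: xab; rewrite in_itv/= => /andP[]; exact: le_trans.
have [M _ fM] := EVT_max leab cf.
have [m _ fm] := EVT_min leab cf.
exists (f M - f m) => _ [[u v] /= [uab vab _] <-].
rewrite ler_norml; have := (fM u uab, fM v vab, fm u uab, fm v vab).
by move=> [[[? ?] ?] ?]; apply/andP; split; lra.
Qed.

Lemma itv_mean_near (a b c e : R) (f : R -> R) : a < b ->
  {within `[a, b], continuous f} ->
  (forall s, s \in `[a, b] -> `|f s - c| <= e) ->
  `|(b - a)^-1 * (\int[lebesgue_measure]_(s in `[a, b]) f s) - c| <= e.
Proof.
move=> ab cf fce.
have mI : measurable (`[a, b] : set (measurableTypeR R)) by exact: measurable_itv.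
have intf : lebesgue_measure.-integrable `[a, b] (EFin \o f).
  by apply: continuous_compact_integrable => //; exact: segment_compact.
have intc (r : R) : lebesgue_measure.-integrable `[a, b] (EFin \o cst r).
  apply: continuous_compact_integrable; first exact: segment_compact.
  by apply: continuous_subspaceT => x; exact: cvg_cst.
have I_cst (r : R) : \int[lebesgue_measure]_(s in `[a, b]) (cst r s) = r * (b - a).
  by rewrite Rintegral_cst//= lebesgue_measure_itv/= lte_fin ab.
have hi : \int[lebesgue_measure]_(s in `[a, b]) f s <= (c + e) * (b - a).
  rewrite -I_cst; apply: le_Rintegral => // s /fce.
  by rewrite ler_norml => /andP[_]; rewrite /cst; lra.
have lo : (c - e) * (b - a) <= \int[lebesgue_measure]_(s in `[a, b]) f s.
  rewrite -I_cst; apply: le_Rintegral => // s /fce.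
  by rewrite ler_norml => /andP[+ _]; rewrite /cst; lra.
have ba : 0 < b - a by rewrite subr_gt0.
move: hi lo; set I := Rintegral _ _ _ => {mI intf intc I_cst fce cf} hi lo.
rewrite ler_norml lerBrDr lerBlDr ![(b - a)^-1 * _]mulrC.
by rewrite ler_pdivlMr// ler_pdivrMr//; apply/andP; split; lra.
Qed.
End Modulus.

(** * Summation by parts and alternating sums *)

Section Sums.
Set Implicit Arguments.
Unset Strict Implicit.
Context {R : realType}.

(** Abel summation arranged so that the tails of [a] appear: tails of an alternating series are
    controlled by their first term. *)
Lemma summation_by_parts (a W : nat -> R) N :
  \sum_(0 <= j < N) a j * (W j.+1 - W 0%N) =
  \sum_(0 <= j < N) (W j.+1 - W j) * \sum_(j <= l < N) a l.
Proof.
elim: N => [|N ih]; first by rewrite !big_geq.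
rewrite big_nat_recr//= ih -(telescope_sumr W (leq0n N.+1)) mulr_sumr.
rewrite big_nat_recr//= [RHS]big_nat_recr//= big_nat1 addrA -big_split/=.
rewrite [X in _ + X]mulrC; congr (_ + _).
rewrite !big_nat; apply: eq_bigr => j /andP[_ jN].
rewrite [in RHS]big_nat_recr ?(ltnW jN)//= [in RHS]mulrDr.
by congr (_ + _); rewrite mulrC.
Qed.

(** Leibniz's criterion, by induction on the number of terms: the signed tail equals [g i] minus the
    next signed tail, which lies between 0 and [g i.+1 <= g i]. The factor [(-1) ^+ i] makes the
    leading term count positively. *)
Lemma alternating_sum_bounds (g : nat -> R) i N :
  (forall j, (i <= j < N)%N -> 0 <= g j) ->
  (forall j, (i <= j)%N -> (j.+1 < N)%N -> g j.+1 <= g j) -> (i < N)%N ->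
  0 <= (-1) ^+ i * \sum_(i <= j < N) (-1) ^+ j * g j <= g i.
Proof.
move=> + + iN; have [k kE] : exists k, (N - i = k.+1)%N.
  by exists (N - i).-1; rewrite prednK// subn_gt0.
elim: k i iN kE => [|k ih] i iN kE g0 gd.
  have -> : N = i.+1 by apply/eqP; rewrite eqn_leq iN andbT -subn_eq0 subnS kE.
  by rewrite big_nat1 mulrA -expr2 sqrr_sign mul1r lexx g0// leqnn.
have iN1 : (i.+1 < N)%N by rewrite -subn_gt0 subnS kE.
rewrite big_ltn// mulrDr mulrA -expr2 sqrr_sign mul1r.
have /andP[] : 0 <= (-1) ^+ i.+1 * \sum_(i.+1 <= j < N) (-1) ^+ j * g j <= g i.+1.
  apply: ih => // [|j /andP[ij jN]|j ij jN]; first by rewrite subnS kE.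
    by apply: g0; rewrite (ltnW ij).
  by apply: gd => //; exact: ltnW.
rewrite exprS -mulrA mulN1r => l u; have := gd i (leqnn i) iN1.
by move=> ?; apply/andP; split; lra.
Qed.

Lemma norm_alternating_sum_le (g : nat -> R) i N :
  (forall j, (i <= j < N)%N -> 0 <= g j) ->
  (forall j, (i <= j)%N -> (j.+1 < N)%N -> g j.+1 <= g j) -> (i < N)%N ->
  `|\sum_(i <= j < N) (-1) ^+ j * g j| <= g i.
Proof.
move=> g0 gd iN; have /andP[l u] := alternating_sum_bounds g0 gd iN.
by rewrite -(normrMsign i) ger0_norm.
Qed.

(** The term [a 0] is kept apart because the alternating form may fail there. The tail from 0 costs
    at most [|a 0|] plus the sum of the [g j], and the tails from [j >= 1] cost [g j] each, whence
    the factor 2. *)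
Lemma sum_by_parts_le (a g W : nat -> R) (s w : R) N :
  `|s| <= 1 -> 0 <= w ->
  (forall j, (j < N)%N -> `|W j.+1 - W j| <= w) ->
  (forall j, (0 < j < N)%N -> a j = s * ((-1) ^+ j * g j)) ->
  (forall j, (0 < j < N)%N -> 0 <= g j) ->
  (forall j, (0 < j)%N -> (j.+1 < N)%N -> g j.+1 <= g j) ->
  `|\sum_(0 <= j < N) a j * (W j.+1 - W 0%N)| <=
  w * (`|a 0%N| + 2 * \sum_(1 <= j < N) g j).
Proof.
move=> s1 w0 Ww aE g0 gd; rewrite summation_by_parts.
have tail i : (0 < i < N)%N -> `|\sum_(i <= l < N) a l| <= g i.
  move=> /andP[i0 iN].
  have -> : \sum_(i <= l < N) a l = s * \sum_(i <= l < N) (-1) ^+ l * g l.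
    rewrite mulr_sumr !big_nat; apply: eq_bigr => l /andP[il lN].
    by rewrite aE// lN (leq_trans i0).
  rewrite normrM.
  have G : `|\sum_(i <= l < N) (-1) ^+ l * g l| <= g i.
    apply: norm_alternating_sum_le => // [j /andP[ij jN]|j ij jN].
      by apply: g0; rewrite jN (leq_trans i0).
    by apply: gd => //; exact: leq_trans ij.
  by apply: le_trans G; rewrite ler_piMl.
case: N => [|N] in Ww aE g0 gd tail *.
  by rewrite !big_geq// normr0 mulr0 addr0 mulr_ge0.
have G0 : 0 <= \sum_(1 <= j < N.+1) g j by rewrite big_nat sumr_ge0.
have T0 : `|\sum_(0 <= l < N.+1) a l| <= `|a 0%N| + \sum_(1 <= j < N.+1) g j.
  rewrite big_ltn// (le_trans (ler_normD _ _))// lerD2l.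
  case: N => [|N] in tail g0 {Ww aE gd} G0 *; first by rewrite !big_geq// normr0.
  apply: le_trans (tail 1%N isT) _;
  rewrite big_ltn// lerDl big_nat sumr_ge0// => j /andP[j1 jN].
  by rewrite g0// jN (ltn_trans _ j1).
rewrite big_ltn// (le_trans (ler_normD _ _))// normrM.
have T1 : `|\sum_(1 <= j < N.+1) (W j.+1 - W j) * \sum_(j <= l < N.+1) a l| <=
    w * \sum_(1 <= j < N.+1) g j.
  rewrite (le_trans (ler_norm_sum _ _ _))// mulr_sumr !big_nat.
  rewrite ler_sum// => j /andP[j0 jN].
  by rewrite normrM ler_pM// ?Ww// tail// j0.
have T2 : `|W 1%N - W 0%N| * `|\sum_(0 <= l < N.+1) a l| <=
    w * (`|a 0%N| + \sum_(1 <= j < N.+1) g j) by rewrite ler_pM// Ww.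
by apply: le_trans (lerD T2 T1) _; rewrite -mulrDr -addrA -mulr2n mulr_natl.
Qed.
End Sums.

(** * Trigonometric inequalities and the cotangent *)

Section Cotangent.
Set Implicit Arguments.
Unset Strict Implicit.
Context {R : realType}.
Implicit Types a b x y p q : R.

Lemma cos_lt x y : 0 <= x -> x < y -> y <= pi -> cos y < cos x.
Proof.
move=> x0 xy ypi; rewrite ltr_cos// in_itv/=; apply/andP; split => //.
  by rewrite (le_trans (ltW xy)).
by rewrite (le_trans x0)// ltW.
Qed.

Lemma cos_le x y : 0 <= x -> x <= y -> y <= pi -> cos y <= cos x.
Proof.
move=> x0; rewrite le_eqVlt => /predU1P[->//|xy ypi].
exact: ltW (cos_lt x0 xy ypi).
Qed.

Definition cot x : R := cos x / sin x.

(** By the mean value theorem [sin x = x * cos c] for some [c] between 0 and [x], and cosine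
    decreases there. *)
Lemma mul_cos_le_sin x : 0 <= x <= pi -> x * cos x <= sin x.
Proof.
move=> /andP[x0 xpi]; move: x0; rewrite le_eqVlt => /predU1P[<-|x0].
  by rewrite mul0r sin0.
have [|c] := @MVT R sin cos 0 x x0.
  by apply: continuous_subspaceT; exact: continuous_sin.
rewrite in_itv/= => /andP[c0 cx]; rewrite sin0 !subr0 => ->.
by rewrite mulrC ler_pM2r// cos_le// ltW.
Qed.

Lemma cotB x y : sin x != 0 -> sin y != 0 ->
  cot x - cot y = sin (y - x) / (sin x * sin y).
Proof. by move=> x0 y0; rewrite /cot sinB; field; rewrite x0 y0. Qed.

Lemma cot_le x y : 0 < x -> x <= y -> y < pi -> cot y <= cot x.
Proof.
move=> x0 xy ypi; have sx : 0 < sin x by apply: sin_gt0_pi; apply/andP; split; lra.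
have sy : 0 < sin y by apply: sin_gt0_pi; apply/andP; split; lra.
rewrite -subr_ge0 cotB ?gt_eqF//; apply: divr_ge0; last by rewrite mulr_ge0// ltW.
by apply: sin_ge0_pi; apply/andP; split; lra.
Qed.

Lemma cot_le_inv x y : 0 < y -> y <= x -> x <= pi / 2 -> cot x <= y^-1.
Proof.
move=> y0 yx xpi; have pi0 := pi_gt0 R.
have sx : 0 < sin x by apply: sin_gt0_pi; apply/andP; split; lra.
rewrite /cot ler_pdivrMr// mulrC ler_pdivlMr//.
have c0 : 0 <= cos x by apply: cos_ge0_pihalf; apply/andP; split; lra.
apply: le_trans (_ : x * cos x <= _); first by rewrite mulrC ler_wpM2r.
by apply: mul_cos_le_sin; apply/andP; split; lra.
Qed.

(** With [b = p + q] and [a = q - p], this splits [sin b / (cos a - cos b)] into cotangents of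
    [(b - a) / 2] and [(b + a) / 2]. *)
Lemma sin_div_cosB p q : sin p != 0 -> sin q != 0 ->
  sin (p + q) / (cos (q - p) - cos (p + q)) = (cot p + cot q) / 2.
Proof.
move=> p0 q0; have -> : cos (q - p) - cos (p + q) = 2 * (sin p * sin q).
  by rewrite cosB cosD; ring.
by rewrite /cot sinD; field; rewrite p0 q0.
Qed.

Lemma cos2Bcos2 x y : cos x ^+ 2 - cos y ^+ 2 = sin (x + y) * sin (y - x).
Proof.
have -> : cos x ^+ 2 - cos y ^+ 2 =
    cos x ^+ 2 * (cos y ^+ 2 + sin y ^+ 2) - (cos x ^+ 2 + sin x ^+ 2) * cos y ^+ 2.
  by rewrite !cos2Dsin2 mulr1 mul1r.
by rewrite sinD sinB; ring.
Qed.

(** With [s] the half sum and [d] the half difference of [x] and [y], clearing denominators leaves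
    [2 * sin d * (cos d - cos a * cos s) >= 0]. This holds since [cos d ^+ 2 - cos s ^+ 2 = sin x *
    sin y >= 0] gives [|cos s| <= cos d]. *)
Lemma sin_div_cosB_antitone a x y : 0 <= x -> x <= y -> y <= pi ->
  cos x < cos a -> sin y / (cos a - cos y) <= sin x / (cos a - cos x).
Proof.
move=> x0 xy ypi xa.
have yx : cos y <= cos x by exact: cos_le.
rewrite ler_pdivlMr; last by rewrite subr_gt0.
rewrite mulrAC ler_pdivrMr; last by rewrite subr_gt0 (le_lt_trans yx).
rewrite -subr_ge0; set d := (y - x) / 2; set s := (x + y) / 2.
have xE : x = s - d by rewrite /s /d; field.
have yE : y = s + d by rewrite /s /d; field.
have -> : sin x * (cos a - cos y) - sin y * (cos a - cos x) =
    2 * sin d * (cos d - cos a * cos s).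
  rewrite -[cos d]mulr1 -[X in cos d * X](cos2Dsin2 s) xE yE sinB sinD cosB cosD.
  by ring.
have sd : 0 <= sin d by apply: sin_ge0_pi; rewrite /d; apply/andP; split; lra.
have cd : 0 <= cos d by apply: cos_ge0_pihalf; rewrite /d; apply/andP; split; lra.
have css : `|cos s| <= cos d.
  rewrite -ler_sqr ?nnegrE// real_normK ?num_real// -subr_ge0.
  have -> : cos d ^+ 2 - cos s ^+ 2 = sin x * sin y.
    by rewrite cos2Bcos2 -xE [d + s]addrC -yE mulrC.
  by rewrite mulr_ge0// sin_ge0_pi//; apply/andP; split; lra.
rewrite mulr_ge0// ?mulr_ge0// subr_ge0 (le_trans (ler_norm _))// normrM.
by rewrite (le_trans _ css)// ler_piMl// cos_max.
Qed.
End Cotangent.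

(** * The Lagrange basis at the Chebyshev nodes as a cosine kernel *)

Section Kernel.
Set Implicit Arguments.
Unset Strict Implicit.
Context {R : realType}.
Implicit Types (n i : nat) (x y t : R).

Definition half_mesh n : R := pi / (2 * n%:R).

(* The kernel of the Chebyshev polynomials: at a node [b] it is [n] times the
   fundamental Lagrange polynomial of [cos b]. *)
Definition cheb_kernel n x y : R :=
  1 + 2 * \sum_(1 <= j < n) cos (j%:R * x) * cos (j%:R * y).

Lemma cheb_angleS n i : cheb_angle R n i.+1 = (2 * i%:R + 1) * half_mesh n.
Proof. by rewrite /cheb_angle /half_mesh -mulrA -natr1; congr (_ * _); ring. Qed.

Lemma mul_half_mesh n : (0 < n)%N -> n%:R * half_mesh n = pi / 2.
Proof.
by move=> n0; rewrite /half_mesh; field; rewrite pnatr_eq0 -lt0n.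
Qed.

Lemma half_mesh_gt0 n : (0 < n)%N -> 0 < half_mesh n.
Proof. by move=> n0; rewrite divr_gt0 ?pi_gt0// mulr_gt0// ltr0n. Qed.

Lemma cos_mulSS n x :
  cos (n.+2%:R * x) = 2 * cos x * cos (n.+1%:R * x) - cos (n%:R * x).
Proof.
have -> : n.+2%:R * x = n.+1%:R * x + x by rewrite -[n.+2%:R]natr1; ring.
have -> : n%:R * x = n.+1%:R * x - x by rewrite -natr1; ring.
by rewrite cosD cosB; ring.
Qed.

(** Induction on [n] through the three-term recurrence [cos_mulSS]. *)
Lemma christoffel_darboux n x y :
  cheb_kernel n.+1 x y * (cos y - cos x) =
  cos (n.+1%:R * y) * cos (n%:R * x) - cos (n%:R * y) * cos (n.+1%:R * x).
Proof.
elim: n => [|n ih].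
  by rewrite /cheb_kernel big_geq// !mul1r !mul0r cos0; ring.
have -> : cheb_kernel n.+2 x y =
    cheb_kernel n.+1 x y + 2 * (cos (n.+1%:R * x) * cos (n.+1%:R * y)).
  by rewrite /cheb_kernel big_nat_recr//= mulrDr addrA.
by rewrite mulrDl ih !cos_mulSS; ring.
Qed.

Lemma cheb_angleM n i : (0 < n)%N ->
  n%:R * cheb_angle R n i.+1 = pi / 2 + pi *+ i.
Proof.
move=> n0; rewrite cheb_angleS mulrCA mul_half_mesh// -mulr_natr.
by field.
Qed.

Lemma cos_cheb_angleM n i : (0 < n)%N -> cos (n%:R * cheb_angle R n i.+1) = 0.
Proof.
by move=> n0; rewrite cheb_angleM// (alternatingn (@cosDpi R)) cos_pihalf mulr0.
Qed.

Lemma sin_cheb_angleM n i : (0 < n)%N ->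
  sin (n%:R * cheb_angle R n i.+1) = (-1) ^+ i.
Proof.
by move=> n0; rewrite cheb_angleM// (alternatingn (@sinDpi R)) sin_pihalf mulr1.
Qed.

(** At a node [b] one has [cos (n b) = 0], so a single product survives in Christoffel-Darboux, and
    [cos ((n - 1) b) = sin (n b) * sin b = (-1) ^+ i * sin b]. *)
Lemma cheb_kernel_angle n i t : (0 < n)%N ->
  cheb_kernel n (cheb_angle R n i.+1) t * (cos t - cos (cheb_angle R n i.+1)) =
  (-1) ^+ i * sin (cheb_angle R n i.+1) * cos (n%:R * t).
Proof.
case: n => // n _; rewrite christoffel_darboux cos_cheb_angleM// mulr0 subr0.
set b := cheb_angle R _ _.
have -> : n%:R * b = n.+1%:R * b - b by rewrite -natr1; ring.
by rewrite cosB cos_cheb_angleM// sin_cheb_angleM//; ring.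
Qed.

Lemma cheb_angle_bounds n i : (i < n)%N ->
  half_mesh n <= cheb_angle R n i.+1 <= pi - half_mesh n.
Proof.
move=> lein; have n0 : (0 < n)%N by exact: leq_trans lein.
have h0 := half_mesh_gt0 n0; have nh := mul_half_mesh n0.
have : (i.+1%:R : R) <= n%:R by rewrite ler_nat.
rewrite cheb_angleS -natr1 => le1; have i0 : 0 <= i%:R :> R by [].
by apply/andP; split; nra.
Qed.

Lemma sin_cheb_angle_gt0 n i : (i < n)%N -> 0 < sin (cheb_angle R n i.+1).
Proof.
move=> lein; have := cheb_angle_bounds lein.
have /half_mesh_gt0 : (0 < n)%N by exact: leq_trans lein.
by move=> h0 /andP[? ?]; apply: sin_gt0_pi; apply/andP; split; lra.
Qed.

Lemma cheb_kernel_continuous n x : continuous (cheb_kernel n x).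
Proof.
move=> t; apply: cvgD; first exact: cvg_cst.
apply: cvgMl_tmp; apply: cvg_big => [|j _]; first exact: add_continuous.
apply: cvgMl_tmp; apply: (@cvg_comp _ _ _ (fun u => j%:R * u) cos).
  apply: cvgMl_tmp; exact: cvg_id.
exact: continuous_cos.
Qed.

(** [cos s - cos t] factors as [-2 sin ((s + t) / 2) sin ((s - t) / 2)]: near [t] the first sine
    stays close to [sin t], and the second is nonzero for [0 < |s - t| < 2]. *)
Lemma cos_neq_near t x : cos t = x -> sin t != 0 ->
  \forall s \near t^', cos s != x.
Proof.
move=> <- sint.
have mid : (u + t) / 2 @[u --> t] --> t.
  have {3}-> : t = (t + t) / 2 by field.
  by apply: cvgMr_tmp; apply: cvgD; [exact: cvg_id|exact: cvg_cst].
have sin_mid : sin ((u + t) / 2) @[u --> t] --> sin t.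
  apply: (@cvg_comp _ _ _ (fun u => (u + t) / 2) sin); first exact: mid.
  exact: continuous_sin.
near=> s.
have st : s != t by near: s; exact: nbhs_dnbhs_neq.
have s1 : sin ((s + t) / 2) != 0.
  near: s; apply: (cvgr_neq0 (sin t)) => //.
  by apply: cvg_within_filter; exact: sin_mid.
have s2 : `|s - t| < 2.
  near: s; apply: nbhs_dnbhs; apply/nbhs_ballP; exists 2 => //= s.
  by rewrite /ball/= distrC.
rewrite -subr_eq0.
have -> : cos s - cos t =
    - (2 * (sin ((s + t) / 2) * sin ((s - t) / 2))).
  have cosDB p q : cos (p + q) - cos (p - q) = - (2 * (sin p * sin q)) :> R.
    by rewrite cosB cosD; ring.
  by rewrite -cosDB; congr (cos _ - cos _); field.
rewrite oppr_eq0 !mulf_neq0//; move: s2; rewrite ltr_norml => /andP[l u].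
move: st; rewrite neq_lt => /orP[st|st].
  rewrite -oppr_eq0 -sinN gt_eqF// sin2_gt0//; apply/andP; split; lra.
by rewrite gt_eqF// sin2_gt0//; apply/andP; split; lra.
Unshelve. all: by end_near.
Qed.

(* [lagrange_quot] has a removable singularity at [t] when [cos t] is a node;
   there the limit is the value of the continuous kernel. *)
Lemma lagrange_basisE n i t : (i < n)%N ->
  lagrange_basis n i.+1 t = n%:R^-1 * cheb_kernel n (cheb_angle R n i.+1) t.
Proof.
move=> lein; have n0 : (0 < n)%N by exact: leq_trans lein.
set b := cheb_angle R n i.+1.
have nR0 : n%:R != 0 :> R by rewrite pnatr_eq0 -lt0n.
have E s : cos s != cos b ->
    lagrange_quot n i.+1 s = n%:R^-1 * cheb_kernel n b s.
  move=> sb; have d0 : cos s - cos b != 0 by rewrite subr_eq0.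
  rewrite /lagrange_quot -/b !exprS.
  have K := cheb_kernel_angle i s n0.
  apply: (mulIf d0); rewrite -[RHS]mulrA K -/b.
  by field; rewrite d0 nR0.
rewrite /lagrange_basis -/b; case: ifPn => [/eqP tb|/E//].
(* Equal cosines force equal squared sines, and the sine of a node is positive. *)
have sint : sin t != 0.
  have /lt0r_neq0 := sin_cheb_angle_gt0 lein.
  by rewrite -[in X in X -> _]sqrf_eq0 -(sqrf_eq0 (sin t)) !sin2cos2 tb.
apply: cvg_lim => //; apply: cvg_trans.
  apply: near_eq_cvg; near=> s; apply/esym/E; near: s.
  exact: cos_neq_near tb sint.
by apply: cvgMl_tmp; apply: cvg_within_filter; exact: cheb_kernel_continuous.
Unshelve. all: by end_near.
Qed.
End Kernel.

(** * The weights of the operator and their decay away from [theta] *)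

Section Weights.
Set Implicit Arguments.
Unset Strict Implicit.
Context {R : realType}.
Implicit Types (n i m : nat) (b h theta : R).

(* Nodes are numbered from [0]: [i] stands for [k - 1]. *)
Definition gk_weight n i theta : R :=
  (lagrange_basis n i.+1 (theta + half_mesh n) +
   lagrange_basis n i.+1 (theta - half_mesh n)) / 2.

(** The [g_i] of the overview, as a function of a real [b] so that monotonicity in the node can be
    stated. *)
Definition gk_decay n h theta b : R :=
  sin b / (2 * n%:R) * ((cos (theta + h) - cos b)^-1 -
                        (cos (theta - h) - cos b)^-1).

Lemma cheb_kernel_norm_le n x y : (0 < n)%N -> `|@cheb_kernel R n x y| <= 2 * n%:R.
Proof.
move=> n0; rewrite /cheb_kernel (le_trans (ler_normD _ _))// normr1 normrM ger0_norm//.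
have : `|\sum_(1 <= j < n) cos (j%:R * x) * cos (j%:R * y)| <= n%:R - 1.
  rewrite (le_trans (ler_norm_sum _ _ _))//.
  apply: (@le_trans _ _ (\sum_(1 <= j < n) 1)).
    by apply: ler_sum => j _; rewrite normrM mulr_ile1 ?cos_max.
  by rewrite big_const_nat iter_addr_0 natrB.
by lra.
Qed.

(** A crude bound that also covers a node where a denominator of [gk_decay] vanishes. *)
Lemma gk_weight_norm_le n i theta : (i < n)%N -> `|gk_weight n i theta| <= 2.
Proof.
move=> lein; have n0 : (0 < n)%N by exact: leq_trans lein.
have L t : `|lagrange_basis n i.+1 t| <= 2 :> R.
  rewrite lagrange_basisE// normrM ger0_norm ?invr_ge0// mulrC ler_pdivrMr ?ltr0n//.
  exact: cheb_kernel_norm_le.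
rewrite /gk_weight normrM [X in _ * X]ger0_norm// ler_pdivrMr//.
by rewrite (le_trans (ler_normD _ _))// mulr2n mulrDr mulr1 lerD.
Qed.

Lemma gk_weightE n i theta : (i < n)%N ->
  cos (theta + half_mesh n) != cos (cheb_angle R n i.+1) ->
  cos (theta - half_mesh n) != cos (cheb_angle R n i.+1) ->
  gk_weight n i theta =
  (-1) ^+ i.+1 * sin (n%:R * theta) *
    gk_decay n (half_mesh n) theta (cheb_angle R n i.+1).
Proof.
move=> lein; have n0 : (0 < n)%N by exact: leq_trans lein.
rewrite /gk_weight /gk_decay !lagrange_basisE//; set b := cheb_angle R n i.+1.
set h := half_mesh n => p0 m0.
have nh : n%:R * h = pi / 2 by exact: mul_half_mesh.
have dp : cos (theta + h) - cos b != 0 by rewrite subr_eq0.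
have dm : cos (theta - h) - cos b != 0 by rewrite subr_eq0.
have -> : cheb_kernel n b (theta + h) =
    (-1) ^+ i * sin b * - sin (n%:R * theta) / (cos (theta + h) - cos b).
  rewrite -cosDpihalf -nh -mulrDr; apply: (canRL (mulfK dp)).
  exact: cheb_kernel_angle.
have -> : cheb_kernel n b (theta - h) =
    (-1) ^+ i * sin b * sin (n%:R * theta) / (cos (theta - h) - cos b).
  rewrite -[sin (n%:R * theta)]cosBpihalf -nh -mulrBr; apply: (canRL (mulfK dm)).
  exact: cheb_kernel_angle.
rewrite exprS; field; rewrite dp dm pnatr_eq0 -lt0n n0//.
Qed.

(** As [theta - h] may be negative, the second inequality comes from [cos (theta - h) - cos (theta +
    h) = 2 sin theta sin h] rather than from monotonicity of cosine. *)
Lemma cos_shift_le h theta b : 0 <= theta -> 0 < h -> h <= pi / 2 ->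
   theta + h < b -> b <= pi ->
  cos b < cos (theta + h) <= cos (theta - h).
Proof.
move=> theta0 h0 hpi tb bpi.
have -> /= : cos b < cos (theta + h) by apply: cos_lt => //; lra.
have : 0 <= sin theta by apply: sin_ge0_pi; apply/andP; split; lra.
have : 0 <= sin h by apply: sin_ge0_pi; apply/andP; split; lra.
by rewrite cosD cosB => s1 s2; nra.
Qed.

Lemma gk_decay_ge0 n h theta b :
  (0 < n)%N -> 0 <= theta -> 0 < h -> h <= pi / 2 ->
   theta + h < b -> b <= pi -> 0 <= gk_decay n h theta b.
Proof.
move=> n0 theta0 h0 hpi tb bpi.
have /andP[c1 c2] := cos_shift_le theta0 h0 hpi tb bpi.
apply: mulr_ge0.
  rewrite divr_ge0// ?mulr_ge0// sin_ge0_pi//; apply/andP; split; lra.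
by rewrite subr_ge0 lef_pV2 ?posrE ?subr_gt0 ?lerB// (lt_le_trans c1).
Qed.

Lemma gk_decay_antitone n h theta b b' :
  (0 < n)%N -> 0 <= theta -> 0 < h -> h <= pi / 2 ->
   theta + h < b -> b <= b' -> b' <= pi ->
  gk_decay n h theta b' <= gk_decay n h theta b.
Proof.
move=> n0 theta0 h0 hpi tb bb bpi.
have /andP[c1 c2] := cos_shift_le theta0 h0 hpi tb (le_trans bb bpi).
have /andP[c3 _] := cos_shift_le theta0 h0 hpi (lt_le_trans tb bb) bpi.
have cb : cos b' <= cos b by apply: cos_le => //; lra.
have c4 : cos b < cos (theta - h) by exact: lt_le_trans c2.
have c5 : cos b' < cos (theta - h) by exact: lt_le_trans c2.
(* A nonnegative constant times two nonnegative factors, each decreasing in [c]. *)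
have decayE c : cos c < cos (theta + h) -> cos c < cos (theta - h) ->
    gk_decay n h theta c = (cos (theta - h) - cos (theta + h)) / (2 * n%:R) *
      (sin c / (cos (theta + h) - cos c) * (cos (theta - h) - cos c)^-1).
  move=> e1 e2; rewrite /gk_decay; field.
  by rewrite pnatr_eq0 -lt0n n0 !subr_eq0 !gt_eqF.
rewrite !decayE//; apply: ler_wpM2l.
  by rewrite divr_ge0// subr_ge0.
apply: ler_pM.
- by rewrite divr_ge0 ?subr_ge0 ?(ltW c3)// sin_ge0_pi//; apply/andP; split; lra.
- by rewrite invr_ge0 subr_ge0 ltW.
- by apply: sin_div_cosB_antitone => //; lra.
- by rewrite lef_pV2 ?posrE ?subr_gt0// lerB.
Qed.

(** Each fraction becomes half a sum of two cotangents. The pair with [b + theta] has a nonpositive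
    difference and is dropped; [b + theta + h < 2 * pi] keeps its angles below [pi]. *)
Lemma gk_decay_le_cot n h theta b :
  (0 < n)%N -> 0 <= theta -> 0 < h -> h <= pi / 2 ->
   theta + h < b -> b <= pi -> b + theta + h < 2 * pi ->
  gk_decay n h theta b <=
  (4 * n%:R)^-1 * (cot ((b - theta - h) / 2) - cot ((b - theta + h) / 2)).
Proof.
move=> n0 theta0 h0 hpi tb bpi sb.
have /andP[c1 c2] := cos_shift_le theta0 h0 hpi tb bpi.
have sn0 (x : R) : 0 < x -> x < pi -> sin x != 0.
  by move=> x0 xpi; rewrite gt_eqF// sin_gt0_pi// x0.
have key (a p q : R) : p + q = b -> q - p = a -> sin p != 0 -> sin q != 0 ->
    sin b * (cos a - cos b)^-1 = (cot p + cot q) / 2.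
  by move=> <- <-; exact: sin_div_cosB.
have e1 : sin b * (cos (theta + h) - cos b)^-1 =
    (cot ((b - theta - h) / 2) + cot ((b + theta + h) / 2)) / 2.
  by apply: key; [field|field|apply: sn0; lra..].
have e2 : sin b * (cos (theta - h) - cos b)^-1 =
    (cot ((b - theta + h) / 2) + cot ((b + theta - h) / 2)) / 2.
  by apply: key; [field|field|apply: sn0; lra..].
have -> : gk_decay n h theta b =
    (2 * n%:R)^-1 * (sin b * (cos (theta + h) - cos b)^-1 -
    sin b * (cos (theta - h) - cos b)^-1).
  by rewrite /gk_decay -mulrBr mulrA [_^-1 * sin b]mulrC.
have -> : (4 * n%:R)^-1 = (2 * n%:R)^-1 / 2 :> R.
  by field; rewrite pnatr_eq0 -lt0n.
rewrite e1 e2 -mulrA; apply: ler_wpM2l; first by rewrite invr_ge0.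
have : cot ((b + theta + h) / 2) <= cot ((b + theta - h) / 2).
  by apply: cot_le; lra.
by lra.
Qed.
End Weights.

(** * The nodes to the right of [theta] *)

Section OneSided.
Set Implicit Arguments.
Unset Strict Implicit.
Context {R : realType}.
Implicit Types (n i m : nat) (b theta : R).

(** The constant is [2 + 2 * (1 / 2)]: the weight of node [m.+1] is at most 2, and the later [g j]
    sum to at most [1 / 2]. *)
Lemma sum_gk_weight_right_le n m theta (W : nat -> R) (w : R) :
  (m < n)%N ->
  2 * m%:R * half_mesh n <= theta <= (2 * m%:R + 2) * half_mesh n ->
  (forall i, (i.+1 < n)%N -> `|W i.+1 - W i| <= w) -> 0 <= w ->
  `|\sum_(m.+1 <= i < n) gk_weight n i theta * (W i - W m)| <= 3 * w.
Proof.
move=> mn /andP[lo hi] Ww w0.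
have [nm|mn1] := leqP n m.+1; first by rewrite big_geq// normr0 mulr_ge0.
have n0 : (0 < n)%N by exact: leq_trans mn.
have nh := @mul_half_mesh R _ n0; have h0 := @half_mesh_gt0 R _ n0.
have bE i := @cheb_angleS R n i.
have bpi i : (i < n)%N -> cheb_angle R n i.+1 <= pi - half_mesh n.
  by move=> /(@cheb_angle_bounds R)/andP[].
have wE := @gk_weightE R n.
set h := half_mesh n in lo hi nh h0 bE bpi wE *.
have n1 : 1 <= n%:R :> R by rewrite ler1n.
have hpi : h <= pi / 2 by rewrite -nh; apply: ler_peMl => //; exact: ltW.
have theta0 : 0 <= theta
  by apply: le_trans lo; apply: mulr_ge0; [exact: mulr_ge0|exact: ltW].
have bS i : cheb_angle R n i.+2 = cheb_angle R n i.+1 + 2 * h.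
  by rewrite !bE -natr1; ring.
(* Node [m.+1] may equal [theta + h], a singular case; from the next node on the gap is at least
   [3 * h]. *)
have far j : theta + 3 * h <= cheb_angle R n (m.+1 + j.+1).+1.
  rewrite bE natrD -!natr1; have : 0 <= j%:R * h by rewrite mulr_ge0// ltW.
  by lra.
have idx j : (j < n - m.+1)%N = (m.+1 + j < n)%N by rewrite ltn_subRL.
pose g j := gk_decay n h theta (cheb_angle R n (m.+1 + j).+1).
(* Weight [m.+1 + j] has sign factor [(-1) ^+ (m + j + 2)]; its part depending on [m] goes into
   [s]. *)
pose s := sin (n%:R * theta) * (-1) ^+ m.
pose c j := cot ((cheb_angle R n (m.+1 + j).+1 - theta - h) / 2).
have s1 : `|s| <= 1 by rewrite normrM normrX normrN1 expr1n mulr1 sin_max.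
have g0 j : (0 < j < n - m.+1)%N -> 0 <= g j.
  case: j => // j; rewrite /= idx => jN; have := far j; have := bpi _ jN.
  by move=> ? ?; apply: gk_decay_ge0 => //; lra.
have gd j : (0 < j)%N -> (j.+1 < n - m.+1)%N -> g j.+1 <= g j.
  case: j => // j _; rewrite idx => jN; have := far j; have := bpi _ jN.
  rewrite /g [in X in X -> _]addnS bS [in X in gk_decay _ _ _ X <= _]addnS bS => ? ?.
  by apply: gk_decay_antitone => //; lra.
have gc j : (0 < j < n - m.+1)%N -> g j <= - (4 * n%:R)^-1 * (c j.+1 - c j).
  case: j => // j; rewrite /= idx => jN; have := far j; have := bpi _ jN.
  move=> b1 b2; rewrite mulNr -mulrN opprB /c [in cot (_ / _) - _]/=.
  (* The node spacing [2 * h] makes the second cotangent of one node the first cotangent of the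
     next, so the bounds telescope. *)
  have -> : (cheb_angle R n (m.+1 + j.+2).+1 - theta - h) / 2 =
      (cheb_angle R n (m.+1 + j.+1).+1 - theta + h) / 2.
    by rewrite [(m.+1 + j.+2)%N]addnS bS; field.
  by apply: gk_decay_le_cot => //; lra.
have sum_g : \sum_(1 <= j < n - m.+1) g j <= 1 / 2.
  have [N1|N1] := leqP (n - m.+1) 1; first by rewrite big_geq// divr_ge0.
  have -> : 1 / 2 = (4 * n%:R)^-1 * (2 * n%:R) :> R.
    by field; rewrite pnatr_eq0 -lt0n.
  apply: le_trans (_ : - (4 * n%:R)^-1 * (c (n - m.+1)%N - c 1%N) <= _).
    rewrite -(telescope_sumr _ (ltnW N1)) mulr_sumr !big_nat.
    by apply: ler_sum => j; exact: gc.
  rewrite mulNr -mulrN opprB ler_wpM2l ?invr_ge0//.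
  have c1 : c 1%N <= h^-1.
    have /bpi b1 : (m.+1 + 1 < n)%N by rewrite -idx.
    by have b2 := far 0%N; apply: cot_le_inv => //; rewrite /=; lra.
  have hV : h^-1 <= 2 * n%:R.
    rewrite invf_ple ?posrE// ?mulr_gt0 ?ltr0n//.
    rewrite -[leLHS]mul1r ler_pdivrMr ?mulr_gt0 ?ltr0n//.
    have -> : h * (2 * n%:R) = pi by rewrite mulrC -mulrA nh; field.
    by have := pi_ge2 R; lra.
  (* Index [n] is one past the last node; its formal angle is [pi + h], so the cotangent is taken at
     [(pi - theta) / 2], in the first quadrant. *)
  have cN : 0 <= c (n - m.+1)%N.
    rewrite /c subnKC// bE.
    have -> : (2 * n%:R + 1) * h = pi + h by rewrite mulrDl mul1r -mulrA nh; field.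
    have pi0 := pi_gt0 R.
    have tpi : theta <= pi.
      have : m%:R + 1 <= n%:R :> R by rewrite natr1 ler_nat.
      by nra.
    apply: divr_ge0; first by apply: cos_ge0_pihalf; apply/andP; split; lra.
    by apply: sin_ge0_pi; apply/andP; split; lra.
  by lra.
have -> : \sum_(m.+1 <= i < n) gk_weight n i theta * (W i - W m) =
    \sum_(0 <= j < n - m.+1)
      gk_weight n (m.+1 + j) theta * (W (m + j.+1)%N - W (m + 0)%N).
  rewrite -{1}[m.+1]add0n big_addn; apply: eq_bigr => j _.
  by rewrite addnC addnS addSn addn0.
pose V j := W (m + j)%N.
apply: le_trans (@sum_by_parts_le R _ g V s w _ s1 w0 _ _ g0 gd) _.
- by move=> j; rewrite idx addSn /V => jN; rewrite addnS; exact: Ww.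
- case=> // j; rewrite /= idx => jN; have := far j; have := bpi _ jN => b1 b2.
  set b := cheb_angle _ _ _ in b1 b2 *.
  have tb : theta + h < b by lra.
  have bp : b <= pi by lra.
  have /andP[c1 c2] := cos_shift_le theta0 h0 hpi tb bp.
  rewrite wE// ?gt_eqF ?(lt_le_trans c1)// /g -/b /s.
  by rewrite addSn addnS !exprS exprD; ring.
- rewrite addn0; have A2 := gk_weight_norm_le theta mn1.
  by have := ler_wpM2l w0 (lerD A2 (ler_wpM2l (ler0n R 2) sum_g)); lra.
Qed.
End OneSided.

(** * Reflection to the left-hand nodes, and the total weight *)

Section Reflection.
Set Implicit Arguments.
Unset Strict Implicit.
Context {R : realType}.
Implicit Types (n i m : nat) (b theta : R).

Lemma cos_mul_reflect j x : cos (j%:R * (pi - x)) = (-1) ^+ j * cos (j%:R * x) :> R.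
Proof.
have -> : j%:R * (pi - x) = - (j%:R * x) + pi *+ j by rewrite -mulr_natl; ring.
by rewrite (alternatingn (@cosDpi R)) cosN.
Qed.

Lemma cheb_kernel_reflect n x y :
  @cheb_kernel R n (pi - x) (pi - y) = cheb_kernel n x y.
Proof.
congr (_ + _ * _); apply: eq_bigr => j _.
by rewrite !cos_mul_reflect mulrACA -expr2 sqrr_sign mul1r.
Qed.

Lemma cheb_angle_reflect n i : (i < n)%N ->
  cheb_angle R n (n - i) = pi - cheb_angle R n i.+1.
Proof.
move=> lein; rewrite /cheb_angle natrB ?(ltnW lein)// -natr1.
by field; rewrite pnatr_eq0 -lt0n (leq_trans _ lein).
Qed.

(** Reflection exchanges the shifts [theta + h] and [theta - h], and the nodes [i] and
    [n - i.+1]. *)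
Lemma gk_weight_reflect n i theta : (i < n)%N ->
  gk_weight n (n - i.+1) (pi - theta) = gk_weight n i theta.
Proof.
move=> lein; have n0 : (0 < n)%N by exact: leq_trans lein.
have lei' : (n - i.+1 < n)%N by rewrite ltn_subrL.
rewrite /gk_weight !lagrange_basisE// subnSK// cheb_angle_reflect//.
set h := half_mesh n.
have -> : pi - theta + h = pi - (theta - h) by ring.
have -> : pi - theta - h = pi - (theta + h) by ring.
by rewrite !cheb_kernel_reflect addrC.
Qed.

Lemma sum_gk_weight_left_le n m theta (W : nat -> R) (w : R) :
  (m < n)%N ->
  2 * m%:R * half_mesh n <= theta <= (2 * m%:R + 2) * half_mesh n ->
  (forall i, (i.+1 < n)%N -> `|W i.+1 - W i| <= w) -> 0 <= w ->
  `|\sum_(0 <= i < m) gk_weight n i theta * (W i - W m)| <= 3 * w.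
Proof.
move=> mn /andP[lo hi] Ww w0; have n0 : (0 < n)%N by exact: leq_trans mn.
have nh := @mul_half_mesh R _ n0.
have -> : \sum_(0 <= i < m) gk_weight n i theta * (W i - W m) =
    \sum_((n - m.+1).+1 <= i < n) gk_weight n i (pi - theta) *
      (W (n - i.+1)%N - W (n - (n - m.+1).+1)%N).
  rewrite big_nat_rev/= -{1}[(n - m.+1).+1]add0n big_addn subnSK// subKn ?(ltnW mn)//.
  rewrite !big_nat; apply: eq_bigr => i /andP[_ im].
  have iE : (i + (n - m) = n - (0 + m - i.+1).+1)%N.
    by rewrite add0n; lia.
  by rewrite iE gk_weight_reflect; [congr (_ * (W _ - W _)); lia|lia].
apply: sum_gk_weight_right_le => //.
- by rewrite ltn_subrL.
- rewrite natrB// -natr1; set h := half_mesh n in lo hi nh *.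
  by apply/andP; split; lra.
- move=> i i1n; rewrite distrC.
  have -> : (n - i.+1 = (n - i.+2).+1)%N by rewrite subnSK.
  by apply: Ww; rewrite subnSK// ltn_subrL.
Qed.

(** Multiplied by [sin (j h) > 0], the sum telescopes to a multiple of [sin (j pi) = 0]. *)
Lemma sum_cos_cheb_angle n j : (0 < j < n)%N ->
  \sum_(0 <= i < n) cos (j%:R * cheb_angle R n i.+1) = 0.
Proof.
move=> /andP[j0 jn]; have n0 : (0 < n)%N by exact: leq_trans jn.
have nh := @mul_half_mesh R _ n0; have h0 := @half_mesh_gt0 R _ n0.
have j0' : 0 < j%:R :> R by rewrite ltr0n.
have jn' : j%:R < n%:R :> R by rewrite ltr_nat.
have sj : 0 < sin (j%:R * half_mesh n) :> R.
  apply: sin_gt0_pi; set h := half_mesh n in nh h0 *.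
  by apply/andP; split; [exact: mulr_gt0|have := pi_gt0 R; nra].
apply: (mulfI (lt0r_neq0 sj)); rewrite mulr0 mulr_sumr.
pose u i := sin (2 * i%:R * (j%:R * half_mesh n)) / 2 : R.
transitivity (\sum_(0 <= i < n) (u i.+1 - u i)).
  apply: eq_bigr => i _; rewrite /u cheb_angleS -[i.+1%:R]natr1; set a := half_mesh n.
  have -> : 2 * (i%:R + 1) * (j%:R * a) = j%:R * ((2 * i%:R + 1) * a) + j%:R * a.
    by ring.
  have -> : 2 * i%:R * (j%:R * a) = j%:R * ((2 * i%:R + 1) * a) - j%:R * a by ring.
  by rewrite sinB sinD; field.
rewrite telescope_sumr// /u mulr0 mul0r sin0 mul0r subr0.
have -> : 2 * n%:R * (j%:R * half_mesh n) = 0 + pi *+ j :> R.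
  have -> : 2 * n%:R * (j%:R * half_mesh n) = 2 * j%:R * (n%:R * half_mesh n) :> R.
    by ring.
  by rewrite nh -mulr_natl; field.
by rewrite (alternatingn (@sinDpi R)) sin0 mulr0 mul0r.
Qed.

(** Summed over the nodes, every cosine term of the kernel cancels and only its constant 1
    remains. *)
Lemma sum_gk_weight n theta : (0 < n)%N ->
  \sum_(0 <= i < n) gk_weight n i theta = 1.
Proof.
move=> n0; have nR0 : n%:R != 0 :> R by rewrite pnatr_eq0 -lt0n.
have L t : \sum_(0 <= i < n) lagrange_basis n i.+1 t = 1 :> R.
  transitivity (n%:R^-1 * \sum_(0 <= i < n) cheb_kernel n (cheb_angle R n i.+1) t).
    rewrite mulr_sumr !big_nat; apply: eq_bigr => i /andP[_ lein].
    exact: lagrange_basisE.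
  rewrite /cheb_kernel big_split/= -mulr_sumr exchange_big_nat/=.
  rewrite [X in 2 * X]big_nat [X in 2 * X]big1 => [|j jn]; last first.
    by rewrite -mulr_suml sum_cos_cheb_angle ?mul0r.
  by rewrite mulr0 addr0 sumr_const_nat subn0 mulVf.
by rewrite /gk_weight -mulr_suml big_split/= !L; field.
Qed.
End Reflection.

(** * Local means of [f] and the choice of the central node *)

Section Mean.
Set Implicit Arguments.
Unset Strict Implicit.
Context {R : realType}.
Implicit Types (n i m : nat) (theta : R).

Definition node_mean n (f : R -> R) i : R :=
  (half_mesh n)^-1 * \int[lebesgue_measure]_(s in
    `[cheb_angle R n i.+1, cheb_angle R n i.+1 + half_mesh n]) f s.

(** The window for [p] is the set of points within [2 * h = pi / n] of both ends of the interval of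
    averaging. *)
Lemma node_mean_near n (f : R -> R) i p : (i < n)%N ->
  {within `[0, pi], continuous f} -> p \in `[0, pi] ->
  cheb_angle R n i.+1 - half_mesh n <= p <=
    cheb_angle R n i.+1 + 2 * half_mesh n ->
  `|node_mean n f i - f p| <= modulus `[0, pi] f (pi / n%:R).
Proof.
move=> lein cf p0pi /andP[lo hi].
have n0 : (0 < n)%N by exact: leq_trans lein.
have h0 := @half_mesh_gt0 R _ n0.
have /andP[b1 b2] := @cheb_angle_bounds R _ _ lein.
have hE : pi / n%:R = 2 * half_mesh n :> R.
  by rewrite /half_mesh; field; rewrite pnatr_eq0 -lt0n.
rewrite /node_mean; set b := cheb_angle R n i.+1 in b1 b2 lo hi *.
rewrite hE; set h := half_mesh n in h0 b1 b2 lo hi *.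
have sub : `[b, b + h] `<=` `[0, pi].
  by apply: subset_itv; rewrite bnd_simp; lra.
have hbh : h = b + h - b by ring.
rewrite {1}hbh; apply: itv_mean_near; first by lra.
  exact: continuous_subspaceW cf.
move=> s sb; apply: le_modulus => //; first exact: sub.
move: sb; rewrite in_itv/= => /andP[sl su].
by rewrite ler_norml; apply/andP; split; lra.
Qed.

(** The prefactor [n / pi] splits into [h^-1] for the mean and [1 / 2] for the weight. *)
Lemma GKE n (f : R -> R) theta : (0 < n)%N ->
  GK n f theta = \sum_(0 <= i < n) gk_weight n i theta * node_mean n f i.
Proof.
move=> n0; have nR0 : n%:R != 0 :> R by rewrite pnatr_eq0 -lt0n.
have piR0 : pi != 0 :> R by rewrite gt_eqF// pi_gt0.
rewrite /GK big_add1/= mulr_sumr; apply: eq_bigr => i _.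
rewrite /gk_weight /node_mean -/(@half_mesh R n).
set I := Rintegral _ _ _; set L := lagrange_basis _ _ _ + _.
rewrite /half_mesh; move: (@pi R) piR0 => p p0.
by field; rewrite nR0 p0.
Qed.

Lemma nearest_node n theta : (0 < n)%N -> 0 <= theta <= pi ->
  exists2 m : nat, (m < n)%N &
    2 * m%:R * half_mesh n <= theta <= (2 * m%:R + 2) * half_mesh n.
Proof.
move=> n0 /andP[t0 tpi]; have nh := @mul_half_mesh R _ n0.
(* The index [n.-1] qualifies because [2 * n * h = pi]; minimality of [m] then gives the lower
   bound. *)
have ex : exists m, theta <= (2 * m%:R + 2) * half_mesh n.
  exists n.-1; rewrite -subn1 natrB//; apply: (le_trans tpi).
  by set h := half_mesh n in nh *; lra.
have [m tm mmin] := ex_minnP ex; exists m.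
  rewrite -(prednK n0) ltnS; apply: mmin; rewrite -subn1 natrB//.
  by apply: (le_trans tpi); set h := half_mesh n in nh *; lra.
rewrite tm andbT; case: m => [|m] in tm mmin *; first by rewrite mulr0 mul0r.
rewrite leNgt; apply/negP => tlt; have /mmin : theta <= (2 * m%:R + 2) * half_mesh n.
  have -> : 2 * m%:R + 2 = 2 * m.+1%:R :> R by rewrite -[m.+1%:R]natr1; ring.
  exact: ltW.
by rewrite ltnn.
Qed.
End Mean.

(** * Assembly of the estimate *)

Theorem theorem2p5 (R : realType) :
  exists2 C : R, 0 < C &
    forall (f : R -> R) (theta : R) (n : nat),
      {within `[0, pi], continuous f} ->
      theta \in `[0, pi] -> (0 < n)%N ->
      let x := cos theta in
      `|GK n f theta - f theta| <=
        C * (modulus `[-1, 1] (f \o @acos R) (Num.sqrt (1 - x ^+ 2) / n%:R) +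
             modulus `[-1, 1] (f \o @acos R) (1 / n%:R ^+ 2) +
             modulus `[0, pi] f (pi / n%:R)).
Proof.
(* [13 = 6 + 6 + 1]: each side contributes [3 * (2 * w)], and replacing the central mean by
   [f theta] costs [w]. *)
exists 13 => // f theta n cf theta_pi n0 /=.
set w := modulus `[0, pi] f _.
have w0 : 0 <= w by exact: modulus_ge0.
apply: (@le_trans _ _ (13 * w)); last first.
  by rewrite ler_pM2l// lerDr addr_ge0// modulus_ge0.
have tpi : 0 <= theta <= pi by move: theta_pi; rewrite in_itv.
have [m mn mtheta] := nearest_node n0 tpi.
have Fw i : (i.+1 < n)%N -> `|node_mean n f i.+1 - node_mean n f i| <= 2 * w.
  move=> i1n; have h0 := @half_mesh_gt0 R _ n0.
  have /andP[b1 b2] := @cheb_angle_bounds R _ _ (ltnW i1n).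
  have bS : cheb_angle R n i.+2 = cheb_angle R n i.+1 + 2 * half_mesh n.
    by rewrite !cheb_angleS -natr1; ring.
  (* The midpoint of two adjacent nodes is in the window of both, so both means are within [w] of
     [f p]. *)
  pose p := cheb_angle R n i.+1 + half_mesh n.
  have pin : p \in `[0, pi] by rewrite in_itv/= /p; apply/andP; split; lra.
  have near_p k : (k < n)%N -> cheb_angle R n k.+1 - half_mesh n <= p <=
      cheb_angle R n k.+1 + 2 * half_mesh n -> `|node_mean n f k - f p| <= w.
    by move=> kn; exact: node_mean_near.
  have p1 : `|node_mean n f i.+1 - f p| <= w.
    by apply: near_p => //; rewrite bS /p; apply/andP; split; lra.
  have p0 : `|node_mean n f i - f p| <= w.
    by apply: near_p (ltnW i1n) _; rewrite /p; apply/andP; split; lra.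
  have -> : node_mean n f i.+1 - node_mean n f i =
      (node_mean n f i.+1 - f p) - (node_mean n f i - f p) by ring.
  by rewrite (le_trans (ler_normB _ _))// mulr2n mulrDl mul1r lerD.
have Fm : `|node_mean n f m - f theta| <= w.
  apply: node_mean_near => //; rewrite cheb_angleS.
  have := @half_mesh_gt0 R _ n0; move: mtheta => /andP[? ?] ?.
  by apply/andP; split; lra.
have w20 : 0 <= 2 * w by exact: mulr_ge0.
have right := sum_gk_weight_right_le mn mtheta Fw w20.
have left := sum_gk_weight_left_le mn mtheta Fw w20.
have -> : GK n f theta - f theta =
    \sum_(0 <= i < m)
      gk_weight n i theta * (node_mean n f i - node_mean n f m) +
    \sum_(m.+1 <= i < n)
      gk_weight n i theta * (node_mean n f i - node_mean n f m) +
    (node_mean n f m - f theta).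
  (* As the weights sum to 1, the central mean can be subtracted from every term; the term [i = m]
     then vanishes. *)
  have -> : GK n f theta = \sum_(0 <= i < n) gk_weight n i theta *
      (node_mean n f i - node_mean n f m) + node_mean n f m.
    rewrite GKE// -[X in _ + X]mul1r -(sum_gk_weight theta n0) mulr_suml -big_split/=.
    by apply: eq_bigr => i _; ring.
  rewrite (big_cat_nat (n := m))//= 1?ltnW// (big_ltn mn) subrr mulr0 add0r.
  by rewrite addrA.
apply: le_trans (ler_normD _ _) _.
apply: (@le_trans _ _ (3 * (2 * w) + 3 * (2 * w) + w)); last by lra.
by apply: lerD Fm; apply: le_trans (ler_normD _ _) (lerD left right).
Qed.
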